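(* Let $S=A[\underline{t};\sigma,\underline{\delta}]$ be a multivariate Ore extension in $n$ variables over a ring $A$. Let $V_1$ and $V_2$ be left $A$-modules that are free with finite bases $\beta_1=\{e_1,\dots,e_{n_1}\}$ and $\beta_2=\{u_1,\dots,u_{n_2}\}$ respectively. Let $T_1=(T_{11},\dots,T_{1n})^t$ and $T_2=(T_{21},\dots,T_{2n})^t$ be $(\sigma,\underline{\delta})$-pseudo-multilinear transformations on $V_1$ and $V_2$ respectively, and regard $V_1$ and $V_2$ as left $S$-modules via $t_i\cdot v=T_{1i}(v)$ for $v\in V_1$ and $t_i\cdot v=T_{2i}(v)$ for $v\in V_2$. Let $\varphi\in \mathrm{Hom}_A(V_1,V_2)$. Let $M\in M_{n_1\times n_2}(A)$, $X_i\in M_{n_1\times n_1}(A)$ and $Y_i\in M_{n_2\times n_2}(A)$ ($1\le i\le n$) be the matrices representing $\varphi$, $T_{1i}$ and $T_{2i}$ in these bases, i.e. $\varphi(e_l)=\sum_k M_{lk}u_k$, $T_{1i}(e_l)=\sum_k (X_i)_{lk}e_k$, $T_{2i}(u_l)=\sum_k (Y_i)_{lk}u_k$. Then the following conditions are equivalent: (i) $\varphi\in \mathrm{Hom}_S(V_1,V_2)$; (ii) $\varphi T_{1i}=T_{2i}\varphi$ for every $1\le i\le n$; (iii) $X_iM=\sum_{j=1}^n\sigma_{ij}(M)Y_j+\delta_i(M)$ for every $1\le i\le n$, where $\sigma_{ij}$ and $\delta_i$ are applied to $M$ entrywise.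
   Context: All rings are associative with identity, and ring homomorphisms preserve the identity. Let $A$ be a ring, $n\ge 1$, $\sigma:A\to M_n(A)$ a ring homomorphism, and write $\sigma_{ij}(a)$ for the $(i,j)$ entry of $\sigma(a)$. Let $\underline{\delta}=(\delta_1,\dots,\delta_n)^t$ be a column of additive maps $A\to A$ forming a $\sigma$-derivation: $\delta_i(ab)=\sum_{j=1}^n\sigma_{ij}(a)\delta_j(b)+\delta_i(a)b$ for all $a,b\in A$, $1\le i\le n$. The multivariate Ore extension $S=A[\underline{t};\sigma,\underline{\delta}]$ is the ring of (finite) sums $\sum_{m\in M}\alpha_m m$, $\alpha_m\in A$, where here $M$ denotes the free monoid on the variables $t_1,\dots,t_n$ (so $S$ is a free left $A$-module with basis this monoid), with multiplication determined by concatenation of words and the rules $t_ia=\sum_{j=1}^n\sigma_{ij}(a)t_j+\delta_i(a)$ for $a\in A$, $1\le i\le n$. A $(\sigma,\underline{\delta})$-pseudo-multilinear transformation on a left $A$-module $V$ is a column $(T_1,\dots,T_n)^t$ of additive endomorphisms of $V$ such that $T_i(a v)=\sum_{j=1}^n\sigma_{ij}(a)T_j(v)+\delta_i(a)v$ for all $a\in A$, $v\in V$, $1\le i\le n$. Setting $t_i\cdot v=T_i(v)$ makes $V$ a left $S$-module extending its $A$-module structure. *)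

(* Defs.v *)
From HB Require Import structures.
From mathcomp Require Import all_boot all_algebra finmap monalg.

Set Implicit Arguments.
Unset Strict Implicit.
Unset Printing Implicit Defensive.

Import GRing.Theory.
Local Open Scope ring_scope.

Record sigma_derivation (A : pzRingType) (n : nat)
    (sigma : {rmorphism A -> 'M[A]_n}) := SigmaDerivation {
  sder :> 'I_n -> {additive A -> A};
  sderM : forall (i : 'I_n) (a b : A),
    sder i (a * b) = \sum_(j < n) sigma a i j * sder j b + sder i a * b
}.

Record pseudo_multilinear (A : pzRingType) (n : nat)
    (sigma : {rmorphism A -> 'M[A]_n}) (delta : sigma_derivation sigma)
    (V : lmodType A) := PseudoMultilinear {
  pml :> 'I_n -> {additive V -> V};
  pmlZ : forall (i : 'I_n) (a : A) (v : V),
    pml i (a *: v) = \sum_(j < n) sigma a i j *: pml j v + delta i a *: v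
}.

Definition is_basis (A : pzRingType) (V : lmodType A) (p : nat)
    (e : 'I_p -> V) : Prop :=
  forall v : V, exists! c : 'rV[A]_p, v = \sum_(i < p) c 0 i *: e i.

(* Finite sums of terms [a m], with [a] in A and [m] a word in t_1, ..., t_n.
   The monoid-algebra product that [malg] carries is not the one of the Ore
   extension and is not inherited. *)
Definition ore (A : pzRingType) (n : nat) (sigma : {rmorphism A -> 'M[A]_n})
  (delta : sigma_derivation sigma) : Type := {malg A[{fmonom 'I_n}]}.

Lemma morphB0 (U W : zmodType) (F : U -> W) :
  {morph F : x y / x - y} -> F 0 = 0.
Proof. by move=> FB; have := FB 0 0; rewrite !subrr. Qed.

Lemma morphBD (U W : zmodType) (F : U -> W) :
  {morph F : x y / x - y} -> {morph F : x y / x + y}.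
Proof.
move=> FB x y; rewrite -{1}[y]opprK FB -[- y]add0r FB (morphB0 FB).
by rewrite sub0r opprK.
Qed.

Section MalgFacts.
Variables (A : pzRingType) (K : choiceType).
Implicit Types (f g : {malg A[K]}) (W : zmodType).

Definition msum (W : zmodType) (F : K -> A -> W) f : W :=
  \sum_(w <- msupp f) F w f@_w.

Lemma msumEw (W : zmodType) (F : K -> A -> W) (d : {fset K}) f :
  (forall w, F w 0 = 0) -> (msupp f `<=` d)%fset ->
  msum F f = \sum_(w <- d) F w f@_w.
Proof.
move=> F0 le; rewrite /msum (big_fset_incl _ le) //= => w _.
by move=> /mcoeff_outdom ->.
Qed.

Lemma msumU (W : zmodType) (F : K -> A -> W) a w :
  (forall w, F w 0 = 0) -> msum F << a *g w >> = F w a.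
Proof.
by move=> F0; rewrite (msumEw F0 msuppU_le) big_seq_fset1 mcoeffUU.
Qed.

Lemma msumB (W : zmodType) (F : K -> A -> W) :
  (forall w a b, F w (a - b) = F w a - F w b) ->
  {morph msum F : f g / f - g}.
Proof.
move=> FB f g; have F0 w : F w 0 = 0 by apply: morphB0; apply: FB.
pose d := (msupp f `|` msupp g)%fset.
rewrite (msumEw (d := d) F0 (msuppB_le _ _)).
rewrite (msumEw (d := d) F0 (fsubsetUl _ _)).
rewrite (msumEw (d := d) F0 (fsubsetUr _ _)) -sumrB.
by apply: eq_bigr => w _; rewrite mcoeffB FB.
Qed.

Lemma malg_eqB (W : zmodType) (F G : {malg A[K]} -> W) :
  {morph F : f g / f - g} -> {morph G : f g / f - g} ->
  (forall a w, F << a *g w >> = G << a *g w >>) -> F =1 G.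
Proof.
move=> FB GB FG f.
rewrite [f]monalgE (big_morph F (morphBD FB) (morphB0 FB))
  (big_morph G (morphBD GB) (morphB0 GB)).
by apply: eq_bigr => w _.
Qed.

End MalgFacts.

(* The operations of the Ore extension are locked: unfolding them through
   [malg] makes unification very slow. *)
Fact ore_key : unit. Proof. exact: tt. Qed.

Section OreModule.
Variables (A : pzRingType) (n : nat) (sigma : {rmorphism A -> 'M[A]_n}).
Variable delta : sigma_derivation sigma.
Local Notation S := (ore delta).
Local Notation malgS := {malg A[{fmonom 'I_n}]}.
Implicit Types (f g : S) (a b : A) (w : {fmonom 'I_n}).

Definition ore_add f g : S := locked_with ore_key (@GRing.add (malgS)) f g.
Definition ore_opp f : S := locked_with ore_key (@GRing.opp (malgS)) f.
Definition ore_zero : S := locked_with ore_key (0 : malgS).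

Definition ore_mon a w : S := locked_with ore_key (@mkmalgU _ A) w a.

(* [ore_sum F f] is the sum of [F w a] over the terms [a w] of [f]. *)
Definition ore_sum (W : zmodType) (F : {fmonom 'I_n} -> A -> W) f : W :=
  locked_with ore_key (@msum A {fmonom 'I_n} W) F f.

Lemma ore_addE : ore_add = @GRing.add malgS.
Proof. by rewrite /ore_add unlock. Qed.
Lemma ore_oppE : ore_opp = @GRing.opp malgS.
Proof. by rewrite /ore_opp unlock. Qed.
Lemma ore_zeroE : ore_zero = 0 :> malgS.
Proof. by rewrite /ore_zero unlock. Qed.

Lemma ore_addA : associative ore_add.
Proof. by move=> f g h; rewrite ore_addE; apply: (@addrA malgS). Qed.
Lemma ore_addC : commutative ore_add.
Proof. by move=> f g; rewrite ore_addE; apply: (@addrC malgS). Qed.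
Lemma ore_add0 : left_id ore_zero ore_add.
Proof. by move=> f; rewrite ore_addE ore_zeroE; apply: (@add0r malgS). Qed.
Lemma ore_addN : left_inverse ore_zero ore_opp ore_add.
Proof.
by move=> f; rewrite ore_addE ore_zeroE ore_oppE; apply: (@addNr malgS).
Qed.

HB.instance Definition _ := Choice.copy S malgS.
HB.instance Definition _ := GRing.isZmodule.Build S
  ore_addA ore_addC ore_add0 ore_addN.

Lemma ore_subE (f g : S) : f - g = (f : malgS) - (g : malgS).
Proof. by rewrite -[LHS]/(ore_add f (ore_opp g)) ore_addE ore_oppE. Qed.

Lemma ore_monB a b w : ore_mon (a - b) w = ore_mon a w - ore_mon b w.
Proof. by rewrite ore_subE /ore_mon unlock; apply: monalgUB. Qed.

Lemma ore_mon0 w : ore_mon 0 w = 0.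
Proof. exact: (morphB0 (fun a b => ore_monB a b w)). Qed.

Lemma ore_monD a b w : ore_mon (a + b) w = ore_mon a w + ore_mon b w.
Proof. exact: (morphBD (fun a b => ore_monB a b w)). Qed.

Lemma ore_sumB (W : zmodType) (F : {fmonom 'I_n} -> A -> W) :
  (forall w a b, F w (a - b) = F w a - F w b) ->
  {morph ore_sum F : f g / f - g}.
Proof.
move=> FB f g; rewrite ore_subE.
have E h : ore_sum F h = msum F h by rewrite /ore_sum locked_withE.
by rewrite !E; apply: msumB.
Qed.

Lemma ore_sum_mon (W : zmodType) (F : {fmonom 'I_n} -> A -> W) a w :
  (forall w, F w 0 = 0) -> ore_sum F (ore_mon a w) = F w a.
Proof. by move=> F0; rewrite /ore_sum /ore_mon !locked_withE; apply: msumU. Qed.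

Lemma ore_eqB (W : zmodType) (F G : S -> W) :
  {morph F : f g / f - g} -> {morph G : f g / f - g} ->
  (forall a w, F (ore_mon a w) = G (ore_mon a w)) -> F =1 G.
Proof.
move=> FB GB FG; apply: malg_eqB => [f g|f g|a w].
- by rewrite -ore_subE FB.
- by rewrite -ore_subE GB.
- by have := FG a w; rewrite /ore_mon unlock.
Qed.

Lemma ore_sumE f : ore_sum (fun w a => ore_mon a w) f = f.
Proof.
move: f; apply: ore_eqB => [||a w] //.
  by apply: ore_sumB => w a b; rewrite ore_monB.
by rewrite ore_sum_mon // => u; rewrite ore_mon0.
Qed.

Definition ore_scale a f : S := ore_sum (fun w b => ore_mon (a * b) w) f.

Lemma ore_scaleB a : {morph ore_scale a : f g / f - g}.
Proof. by apply: ore_sumB => w b c; rewrite mulrBr ore_monB. Qed.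

Lemma ore_scale_mon a b w : ore_scale a (ore_mon b w) = ore_mon (a * b) w.
Proof. by rewrite /ore_scale ore_sum_mon // => u; rewrite mulr0 ore_mon0. Qed.

Lemma ore_scaleA a b f : ore_scale a (ore_scale b f) = ore_scale (a * b) f.
Proof.
move: f; apply: ore_eqB => [f g|f g|c w]; rewrite ?ore_scaleB.
- by [].
- by [].
- by rewrite !ore_scale_mon mulrA.
Qed.

Lemma ore_scale1 : left_id 1 ore_scale.
Proof.
by apply: ore_eqB => [f g|f g|c w]; rewrite ?ore_scaleB ?ore_scale_mon ?mul1r.
Qed.

Lemma ore_scaleDr : right_distributive ore_scale +%R.
Proof.
by move=> a; apply: morphBD; apply: ore_scaleB.
Qed.

Lemma ore_scaleDl f : {morph ore_scale^~ f : a b / a + b}.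
Proof.
move=> a b; move: f; apply: ore_eqB => [f g|f g|c w]; rewrite ?ore_scaleB.
- by [].
- by rewrite opprD addrACA.
- by rewrite !ore_scale_mon mulrDl ore_monD.
Qed.

HB.instance Definition _ := GRing.Zmodule_isLmodule.Build A S
  ore_scaleA ore_scale1 ore_scaleDr ore_scaleDl.

Lemma oreZ_mon a b w : a *: ore_mon b w = ore_mon (a * b) w.
Proof. exact: ore_scale_mon. Qed.

Section Act.
Variables (V : lmodType A) (T : pseudo_multilinear delta V).

(* The word t_{i_1} ... t_{i_k} acts as T_{i_1} o ... o T_{i_k}. *)
Definition pml_word (w : {fmonom 'I_n}) (v : V) : V := foldr (fun i => T i) v w.

Definition pml_act (f : S) (v : V) : V :=
  ore_sum (fun w a => a *: pml_word w v) f.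

Lemma pml_wordB w : {morph pml_word w : u v / u - v}.
Proof.
by rewrite /pml_word => u v; elim: (w : seq _) => //= i s ->; rewrite raddfB.
Qed.

Lemma pml_actBl v : {morph pml_act^~ v : f g / f - g}.
Proof. by apply: ore_sumB => w a b; rewrite scalerBl. Qed.

Lemma pml_act_mon a w v : pml_act (ore_mon a w) v = a *: pml_word w v.
Proof. by rewrite /pml_act ore_sum_mon // => u; rewrite scale0r. Qed.

Lemma pml_actBr f : {morph pml_act f : u v / u - v}.
Proof.
move=> u v; move: f; apply: ore_eqB => [f g|f g|a w].
- by rewrite pml_actBl.
- by rewrite !pml_actBl !opprB addrACA [- _ + _]addrC [in RHS]addrACA.
- by rewrite !pml_act_mon pml_wordB scalerBr.
Qed.

Lemma pml_act0l v : pml_act 0 v = 0.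
Proof. exact: (morphB0 (pml_actBl v)). Qed.

Lemma pml_act0r f : pml_act f 0 = 0.
Proof. exact: (morphB0 (pml_actBr f)). Qed.

Lemma pml_actDl v : {morph pml_act^~ v : f g / f + g}.
Proof. exact: (morphBD (pml_actBl v)). Qed.

Lemma pml_actDr f : {morph pml_act f : u v / u + v}.
Proof. exact: (morphBD (pml_actBr f)). Qed.

Lemma pml_actZ a f v : pml_act (a *: f) v = a *: pml_act f v.
Proof.
move: f; apply: ore_eqB => [f g|f g|b w].
- by rewrite scalerBr pml_actBl.
- by rewrite pml_actBl scalerBr.
- by rewrite oreZ_mon !pml_act_mon scalerA.
Qed.

End Act.

(* Left multiplication by [t_i]:
   t_i (a m) = sum_j sigma_ij(a) (t_j m) + delta_i(a) m. *)
Definition ore_lmulX (i : 'I_n) (f : S) : S :=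
  ore_sum (fun w a => \sum_(j < n) ore_mon (sigma a i j) (mmul (fmu j) w)
                   + ore_mon (delta i a) w) f.

Lemma ore_lmulX_is_additive i : {morph ore_lmulX i : f g / f - g}.
Proof.
apply: ore_sumB => w a b; rewrite (raddfB sigma) (raddfB (delta i)) ore_monB.
rewrite opprD addrACA -sumrB; congr (_ + _); apply: eq_bigr => j _.
by rewrite -ore_monB !mxE.
Qed.

HB.instance Definition _ i :=
  GRing.isZmodMorphism.Build S S (ore_lmulX i) (ore_lmulX_is_additive i).

Lemma ore_lmulX_mon i a w :
  ore_lmulX i (ore_mon a w) =
  \sum_(j < n) ore_mon (sigma a i j) (mmul (fmu j) w) + ore_mon (delta i a) w.
Proof.
rewrite /ore_lmulX ore_sum_mon // => u.
rewrite (raddf0 sigma) (raddf0 (delta i)) ore_mon0 addr0 big1 // => j _.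
by rewrite mxE ore_mon0.
Qed.

Lemma sder1 i : delta i 1 = 0.
Proof.
have := sderM delta i 1 1; rewrite !mulr1 rmorph1 (bigD1 i) //=.
rewrite mxE eqxx mul1r big1 => [/eqP|j /negbTE ji].
  by rewrite addr0 -subr_eq subrr eq_sym => /eqP.
by rewrite mxE eq_sym ji mul0r.
Qed.

Lemma ore_lmulX_mon1 i w : ore_lmulX i (ore_mon 1 w) = ore_mon 1 (mmul (fmu i) w).
Proof.
rewrite ore_lmulX_mon sder1 ore_mon0 addr0 rmorph1 (bigD1 i) //= mxE eqxx.
by rewrite big1 ?addr0 // => j /negbTE ji; rewrite mxE eq_sym ji ore_mon0.
Qed.

Lemma ore_lmulXZ i a f :
  ore_lmulX i (a *: f) =
  \sum_(j < n) sigma a i j *: ore_lmulX j f + delta i a *: f.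
Proof.
move: f; apply: ore_eqB => [f g|f g|b w].
- by rewrite scalerBr raddfB.
- rewrite (scalerBr _ f g) opprD addrACA -sumrB; congr (_ + _).
  by apply: eq_bigr => j _; rewrite raddfB scalerBr.
rewrite oreZ_mon ore_lmulX_mon sderM rmorphM ore_monD oreZ_mon addrA.
congr (_ + _); under [RHS]eq_bigr => j _.
  by rewrite ore_lmulX_mon scalerDr scaler_sumr oreZ_mon; over.
rewrite big_split /=; congr (_ + _); last first.
  by rewrite (big_morph (ore_mon^~ w) (fun a b => ore_monD a b w) (ore_mon0 w)).
rewrite exchange_big /=; apply: eq_bigr => k _.
rewrite mxE (big_morph (ore_mon^~ (mmul (fmu k) w))
  (fun a b => ore_monD a b (mmul (fmu k) w)) (ore_mon0 _)).
by apply: eq_bigr => j _; rewrite oreZ_mon.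
Qed.

Definition ore_lmul : pseudo_multilinear delta S :=
  PseudoMultilinear ore_lmulXZ.

Definition ore_one : S := ore_mon 1 mone.

(* A word t_{i_1} ... t_{i_k} multiplies [g] by successive left
   multiplications by its letters. *)
Definition ore_mul (f g : S) : S := pml_act ore_lmul f g.

Lemma pml_act1 (V : lmodType A) (T : pseudo_multilinear delta V) v :
  pml_act T ore_one v = v.
Proof. by rewrite pml_act_mon scale1r /pml_word fm1. Qed.

Lemma pml_act_lmulX (V : lmodType A) (T : pseudo_multilinear delta V) i f v :
  pml_act T (ore_lmulX i f) v = T i (pml_act T f v).
Proof.
move: f; apply: ore_eqB => [f g|f g|a w].
- by rewrite raddfB pml_actBl.
- by rewrite pml_actBl raddfB.
rewrite ore_lmulX_mon pml_actDl !pml_act_mon pmlZ; congr (_ + _).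
rewrite (big_morph (fun f => pml_act T f v) (fun f g => pml_actDl T v f g)
                   (pml_act0l T v)).
by apply: eq_bigr => j _; rewrite pml_act_mon /pml_word fmM fmU.
Qed.

Lemma pml_actM (V : lmodType A) (T : pseudo_multilinear delta V) f g v :
  pml_act T f (pml_act T g v) = pml_act T (ore_mul f g) v.
Proof.
move: f; apply: ore_eqB => [f h|f h|a w]; rewrite /ore_mul ?pml_actBl //.
rewrite !pml_act_mon pml_actZ; congr (_ *: _); rewrite /pml_word.
elim: (w : seq _) => //= i s ->.
by rewrite pml_act_lmulX.
Qed.

Lemma ore_mulA : associative ore_mul.
Proof. by move=> f g h; rewrite /ore_mul pml_actM. Qed.

Lemma ore_mul1 : left_id ore_one ore_mul.
Proof. by move=> f; rewrite /ore_mul pml_act1. Qed.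

Lemma ore_mulr1 : right_id ore_one ore_mul.
Proof.
apply: ore_eqB => [f g|f g|a w] //; first by rewrite /ore_mul pml_actBl.
rewrite /ore_mul pml_act_mon -[in RHS](mulr1 a) -oreZ_mon; congr (_ *: _).
rewrite /pml_word; case: w => s /=; elim: s => [|i s IH] /=.
  by congr (ore_mon _ _); apply: val_inj; rewrite /= fm1.
rewrite IH ore_lmulX_mon1; congr (ore_mon _ _).
by apply: val_inj; rewrite /= fmM fmU.
Qed.

Lemma ore_mulDl : left_distributive ore_mul +%R.
Proof. by move=> f g h; rewrite /ore_mul pml_actDl. Qed.

Lemma ore_mulDr : right_distributive ore_mul +%R.
Proof. by move=> f g h; rewrite /ore_mul pml_actDr. Qed.

HB.instance Definition _ := GRing.Zmodule_isPzRing.Build S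
  ore_mulA ore_mul1 ore_mulr1 ore_mulDl ore_mulDr.

Definition oreC a : S := ore_mon a mone.
Definition oreX (i : 'I_n) : S := ore_mon 1 (fmu i).

Lemma oreM_lmul f g : f * g = pml_act ore_lmul f g.
Proof. by []. Qed.

Lemma oreCM a f : oreC a * f = a *: f.
Proof. by rewrite oreM_lmul pml_act_mon /pml_word fm1. Qed.

Lemma oreXM i f : oreX i * f = ore_lmulX i f.
Proof. by rewrite oreM_lmul pml_act_mon scale1r /pml_word fmU. Qed.

Lemma oreC_is_zmod_morphism : zmod_morphism oreC.
Proof. by move=> a b; apply: ore_monB. Qed.

Lemma oreC_is_monoid_morphism : monoid_morphism oreC.
Proof. by split=> // a b; rewrite oreCM oreZ_mon. Qed.

HB.instance Definition _ := GRing.isZmodMorphism.Build A S oreC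
  oreC_is_zmod_morphism.
HB.instance Definition _ := GRing.isMonoidMorphism.Build A S oreC
  oreC_is_monoid_morphism.

(* The rules that determine the product. *)
Lemma oreX_mulC i a :
  oreX i * oreC a = \sum_(j < n) oreC (sigma a i j) * oreX j + oreC (delta i a).
Proof.
rewrite oreXM ore_lmulX_mon; congr (_ + _); apply: eq_bigr => j _.
rewrite oreCM oreZ_mon mulr1; congr ore_mon.
by apply: val_inj; rewrite /= fmM fm1 fmU.
Qed.

Lemma ore_mon_prod a w : ore_mon a w = oreC a * \prod_(i <- w : seq _) oreX i.
Proof.
rewrite oreCM -[in LHS](mulr1 a) -oreZ_mon; congr (_ *: _).
case: w => s /=; elim: s => [|i s IH].
  by rewrite big_nil; congr ore_mon; apply: val_inj; rewrite /= fm1.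
rewrite big_cons -IH oreXM ore_lmulX_mon1; congr ore_mon.
by apply: val_inj; rewrite /= fmM fmU.
Qed.

(* [V] with the left S-module structure for which t_i acts as [T i]. *)
Definition ore_module (V : lmodType A) (T : pseudo_multilinear delta V) : Type :=
  V.

Section OreModuleInstance.
Variables (V : lmodType A) (T : pseudo_multilinear delta V).

HB.instance Definition _ := GRing.Zmodule.on (ore_module T).

HB.instance Definition _ := GRing.Zmodule_isLmodule.Build S (ore_module T)
  (@pml_actM V T) (@pml_act1 V T) (@pml_actDr V T) (@pml_actDl V T).

Lemma ore_moduleC (a : A) (v : V) : oreC a *: (v : ore_module T) = a *: v.
Proof. by rewrite [LHS]pml_act_mon /pml_word fm1. Qed.

Lemma ore_moduleX (i : 'I_n) (v : V) : oreX i *: (v : ore_module T) = T i v.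
Proof. by rewrite [LHS]pml_act_mon scale1r /pml_word fmU. Qed.

End OreModuleInstance.
End OreModule.

(* Main.v *)
Require Import Defs.
From mathcomp Require Import all_boot all_algebra.

Import GRing.Theory.
Local Open Scope ring_scope.

(** [S] is generated by [A] and the [t_i], and [phi] is already [A]-linear, so [S]-linearity only
    asks that [phi] commute with the action of each [t_i], that is, with [T1 i] and [T2 i]
    ([ore_linearP]). This commutation need only be tested on the basis [e] ([commutes_on_basis]).
    There, in the coordinates of [u], [phi (T1 i (e l))] is row [l] of [X i *m M] ([phi_pml_basis]),
    while the twisted Leibniz rule for [T2 i] makes [T2 i (phi (e l))] row [l] of the right-hand
    side of the matrix identity ([pml_phi_basis]). Uniqueness of coordinates in [u] turns equality
    of vectors into equality of rows. *)

Section Bases.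
Set Implicit Arguments.
Unset Strict Implicit.

Lemma is_basis_ind (A : pzRingType) (V : lmodType A) (p : nat) (e : 'I_p -> V)
    (P : V -> Prop) :
  is_basis e -> P 0 -> (forall v w, P v -> P w -> P (v + w)) ->
  (forall a v, P v -> P (a *: v)) -> (forall l, P (e l)) -> forall v, P v.
Proof.
move=> e_basis P0 PD PZ Pe v; have [c [-> _]] := e_basis v.
by elim/big_ind: _ => // l _; apply: PZ.
Qed.

Lemma is_basis_coord_inj (A : pzRingType) (V : lmodType A) (p : nat)
    (e : 'I_p -> V) (c d : 'I_p -> A) :
  is_basis e -> \sum_(i < p) c i *: e i = \sum_(i < p) d i *: e i -> c =1 d.
Proof.
move=> e_basis cd i.
have [x [_ x_uniq]] := e_basis (\sum_(i < p) c i *: e i).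
have xc : x = \row_i c i.
  by apply: x_uniq; apply: eq_bigr => j _; rewrite mxE.
have xd : x = \row_i d i.
  by apply: x_uniq; rewrite cd; apply: eq_bigr => j _; rewrite mxE.
by move: xd; rewrite xc => /rowP/(_ i); rewrite !mxE.
Qed.

(** With scalars on the left and images stored as rows, substitution multiplies matrices in the
    order [B *m C], which matters since [A] need not be commutative. *)
Lemma sum_mulmx_scale (A : pzRingType) (V : lmodType A) (m p q : nat)
    (B : 'M[A]_(m, p)) (C : 'M[A]_(p, q)) (u : 'I_q -> V) (l : 'I_m) :
  \sum_(k < p) B l k *: (\sum_(r < q) C k r *: u r) =
  \sum_(r < q) (B *m C) l r *: u r.
Proof.
under eq_bigr => k _ do rewrite scaler_sumr.
rewrite exchange_big; apply: eq_bigr => r _ /=.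
by rewrite mxE scaler_suml; apply: eq_bigr => k _; rewrite scalerA.
Qed.

End Bases.

Section PseudoMultilinearMaps.
Set Implicit Arguments.
Unset Strict Implicit.
Variables (A : pzRingType) (n : nat) (sigma : {rmorphism A -> 'M[A]_n}).
Variable delta : sigma_derivation sigma.
Variables (V1 V2 : lmodType A).
Variables (T1 : pseudo_multilinear delta V1) (T2 : pseudo_multilinear delta V2).
Variable phi : {linear V1 -> V2}.

(** Both sides are additive in [f], so a single term [a w] suffices: [a] passes through [phi] by
    linearity, and the letters of [w] one at a time. *)
Lemma pml_act_commutes :
  (forall i, phi \o T1 i =1 T2 i \o phi) ->
  forall f v, phi (pml_act T1 f v) = pml_act T2 f (phi v).
Proof.
move=> comm f v; move: f; apply: ore_eqB => [f g|f g|a w].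
- by rewrite pml_actBl raddfB.
- by rewrite pml_actBl.
rewrite !pml_act_mon linearZ /=; congr (_ *: _); rewrite /pml_word.
by case: w => s /=; elim: s => //= i s <-; apply: comm.
Qed.

Lemma ore_linearP :
  linear (phi : ore_module T1 -> ore_module T2) <->
  (forall i, phi \o T1 i =1 T2 i \o phi).
Proof.
split=> [phiL i v | comm f v w].
  (* Linearity at the scalar [t_i], with zero as second summand, is exactly commutation with
     [T i]. *)
  have := phiL (oreX delta i) v 0.
  by rewrite (raddf0 phi) !addr0 !ore_moduleX.
by rewrite [LHS]raddfD; congr (_ + _); apply: pml_act_commutes.
Qed.

(* The vectors on which phi commutes with all the T_i at once form an
   A-submodule: T_i (a v) involves every T_j v. *)
Lemma commutes_on_basis (p : nat) (e : 'I_p -> V1) :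
  is_basis e ->
  (forall i l, phi (T1 i (e l)) = T2 i (phi (e l))) ->
  forall i, phi \o T1 i =1 T2 i \o phi.
Proof.
move=> e_basis comm_e i v /=; move: v i.
apply: (is_basis_ind e_basis) => [i|v w Hv Hw i|a v Hv i|l i] //.
- by rewrite !raddf0.
- by rewrite raddfD linearD Hv Hw -raddfD -linearD.
rewrite pmlZ linearD linear_sum !linearZ pmlZ /=; congr (_ + _).
by apply: eq_bigr => j _; rewrite linearZ /= Hv.
Qed.

Section Matrices.
Variables (n1 n2 : nat) (e : 'I_n1 -> V1) (u : 'I_n2 -> V2).
Variables (M : 'M[A]_(n1, n2)) (X : 'I_n -> 'M[A]_n1) (Y : 'I_n -> 'M[A]_n2).
Hypothesis M_phi : forall l, phi (e l) = \sum_(k < n2) M l k *: u k.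
Hypothesis X_T1 : forall i l, T1 i (e l) = \sum_(k < n1) X i l k *: e k.
Hypothesis Y_T2 : forall i l, T2 i (u l) = \sum_(k < n2) Y i l k *: u k.

Lemma phi_pml_basis i l :
  phi (T1 i (e l)) = \sum_(r < n2) (X i *m M) l r *: u r.
Proof.
rewrite X_T1 linear_sum -sum_mulmx_scale; apply: eq_bigr => k _.
by rewrite linearZ /= M_phi.
Qed.

(** [T2 i] is not [A]-linear: applied to [M l k *: u k], it yields the terms in [sigma] that
    multiply [Y j], plus the [delta] term. *)
Lemma pml_phi_basis i l :
  T2 i (phi (e l)) =
  \sum_(r < n2) (\sum_(j < n) map_mx (fun a => sigma a i j) M *m Y j
                 + map_mx (delta i) M) l r *: u r.
Proof.
rewrite M_phi raddf_sum.
under eq_bigr => k _ do rewrite pmlZ.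
under [RHS]eq_bigr => r _ do rewrite mxE scalerDl summxE scaler_suml.
rewrite !big_split /=; congr (_ + _); last by apply: eq_bigr => k _; rewrite mxE.
rewrite exchange_big [RHS]exchange_big /=; apply: eq_bigr => j _.
by rewrite -sum_mulmx_scale; apply: eq_bigr => k _; rewrite mxE Y_T2.
Qed.

End Matrices.
End PseudoMultilinearMaps.

Theorem theorem2p7 (A : pzRingType) (n : nat) (n_gt0 : (0 < n)%N)
    (sigma : {rmorphism A -> 'M[A]_n}) (delta : sigma_derivation sigma)
    (n1 n2 : nat) (V1 V2 : lmodType A)
    (e : 'I_n1 -> V1) (u : 'I_n2 -> V2) (e_basis : is_basis e) (u_basis : is_basis u)
    (T1 : pseudo_multilinear delta V1) (T2 : pseudo_multilinear delta V2)
    (phi : {linear V1 -> V2})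
    (M : 'M[A]_(n1, n2)) (X : 'I_n -> 'M[A]_n1) (Y : 'I_n -> 'M[A]_n2)
    (M_phi : forall l : 'I_n1, phi (e l) = \sum_(k < n2) M l k *: u k)
    (X_T1 : forall (i : 'I_n) (l : 'I_n1),
       T1 i (e l) = \sum_(k < n1) X i l k *: e k)
    (Y_T2 : forall (i : 'I_n) (l : 'I_n2),
       T2 i (u l) = \sum_(k < n2) Y i l k *: u k) :
  let phi_is_S_linear :=
    linear (phi : ore_module T1 -> ore_module T2) in
  let phi_commutes :=
    forall i : 'I_n, phi \o T1 i =1 T2 i \o phi in
  let matrix_identity :=
    forall i : 'I_n,
      X i *m M = \sum_(j < n) map_mx (fun a => sigma a i j) M *m Y j
                 + map_mx (delta i) M in
  (phi_is_S_linear <-> phi_commutes) /\ (phi_commutes <-> matrix_identity).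
Proof.
split; first exact: ore_linearP.
split=> [comm i | mx_eq].
  (* Row [l] of each side is read as the coordinates in [u] of an image of [e l]. *)
  apply/matrixP => l; apply: (is_basis_coord_inj u_basis).
  rewrite -(phi_pml_basis M_phi X_T1) -(pml_phi_basis M_phi Y_T2).
  exact: comm.
apply: (commutes_on_basis e_basis) => i l.
by rewrite (phi_pml_basis M_phi X_T1) (pml_phi_basis M_phi Y_T2) mx_eq.
Qed.
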